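(* Let $(\Omega,\mathcal A,\mu)$ be a $\sigma$-finite measure space and $K\in(0,\mu(\Omega))$. Let $X$ be a reflexive Banach space that is compactly and densely embedded in $L^1(\Omega)$, and let $f:X\to\mathbb R$ be lower semicontinuous, convex, bounded from below, coercive and Gateaux-differentiable. Let $(\rho_n)$ be a sequence of positive numbers with $\lim_{n\to\infty}\rho_n=\infty$, and let $(u_n)\subseteq X$ be such that, for each $n$, $u_n$ is a critical point of the penalized problem $$\min_{u\in X}f(u)+\rho_n(\|u\|_1-|u|_K).$$ Then $(u_n)$ is bounded in $X$ and $\|u_n\|_1-|u_n|_K\to0$. Moreover, every weak accumulation point $\bar u$ of $(u_n)$ (weak limit in $X$ of a subsequence) satisfies $\|\bar u\|_0\le K$ and $f(\bar u)\le f(0)$. In addition, $$\langle f'(u_n),u_n\rangle\in\Big[\inf_{v\in X}f(v)-f(0),\ 0\Big]\qquad\forall n\in\mathbb N.$$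
   Context: $\|u\|_0:=\mu(\{x\in\Omega\mid u(x)\ne0\})$. The largest-$K$-norm is $|u|_K:=\sup_{A\in\mathcal A:\ \mu(A)\le K}\int_A|u|\,d\mu$; $\|u\|_1$ is the $L^1(\Omega)$-norm. $f$ is coercive if $\|u_n\|_X\to\infty$ implies $f(u_n)\to\infty$. The convex subdifferential of $\phi$ on $X$ is $\partial\phi(u)=\{s\in X'\mid\phi(v)-\phi(u)\ge\langle s,v-u\rangle\ \forall v\in X\}$. A point $u$ is a critical point of the penalized problem with parameter $\rho$ if, with $g:=f+\rho\|\cdot\|_1$ and $h:=\rho|\cdot|_K$ on $X$, one has $\partial g(u)\cap\partial h(u)\ne\emptyset$; equivalently, there are $s\in\partial|\cdot|_K(u)$ and $r\in\partial\|\cdot\|_1(u)$ with $0=f'(u)+\rho(r-s)$ in $X'$. *)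

(* Defs.v *)
From HB Require Import structures.
From mathcomp Require Import all_boot all_order all_algebra.
From mathcomp Require Import all_classical all_reals all_analysis.

Set Implicit Arguments.
Unset Strict Implicit.
Unset Printing Implicit Defensive.

Import Order.TTheory GRing.Theory Num.Theory.
Import numFieldNormedType.Exports.

Local Open Scope classical_set_scope.
Local Open Scope ring_scope.

Section L1.
Context d (T : measurableType d) (R : realType).
Variable mu : {measure set T -> \bar R}.
Implicit Types g h : LspaceType1 mu.

(* Elements of [LspaceType1 mu] are classes of a.e. equal functions; applied to
   a point they stand for a representative, and the quantities below do not
   depend on the choice of that representative. *)

Definition norm0 g : \bar R := mu [set x | (g x : R) != 0].

Definition norm1 g : R := fine ('N[mu]_1 [EFin \o (g : T -> R)])%E.

(* [LspaceType1 mu] carries neither algebra nor topology in the library, hence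
   the direct definition of the distance. *)
Definition dist1 g h : R :=
  fine ('N[mu]_1 [EFin \o (fun x => (g x : R) - (h x : R))%R])%E.

(* The supremum is bounded by the L1 norm, so that [fine] loses nothing. *)
Definition largestK_norm (K : R) g : R :=
  fine (ereal_sup
    [set (\int[mu]_(x in A) `|(g x : R)%:E|)%E
      | A in [set A | measurable A /\ (mu A <= K%:E)%E]]).

End L1.

Section dual.
Context (R : realType) (X : normedModType R).

(* the topological dual X' *)
Definition dual : set (X -> R^o) := [set s | linear s /\ continuous s].

Definition dual_norm (s : X -> R^o) : R :=
  sup [set `|s x| | x in [set x | `|x| <= 1]].

(* The functionals on X' are given as functions on all of [X -> R^o], of which
   only the values on X' matter. *)
Definition bidual : set ((X -> R^o) -> R) :=
  [set Phi |
    (forall (a : R) (s t : X -> R^o), dual s -> dual t ->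
       Phi (a *: s + t) = a * Phi s + Phi t) /\
    (exists C : R, forall s, dual s -> `|Phi s| <= C * dual_norm s)].

Definition reflexive_space : Prop :=
  forall Phi, bidual Phi -> exists x : X, forall s, dual s -> Phi s = s x.

Definition weak_cvg (u : nat -> X) (l : X) : Prop :=
  forall s, dual s -> s (u n) @[n --> \oo] --> s l.

Definition weak_accumulation_point (u : nat -> X) (l : X) : Prop :=
  exists2 phi : nat -> nat, increasing_seq phi & weak_cvg (u \o phi) l.

Definition coercive (f : X -> R^o) : Prop :=
  forall u : nat -> X, `|u n| @[n --> \oo] --> +oo ->
    f (u n) @[n --> \oo] --> +oo.

Definition gateaux_derivative (f : X -> R^o) (u : X) : X -> R^o :=
  fun v => 'D_v f u.

Definition gateaux_differentiable (f : X -> R^o) : Prop :=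
  forall u, (forall v, derivable f u v) /\ dual (gateaux_derivative f u).

Definition subdifferential (phi : X -> R^o) (u : X) : set (X -> R^o) :=
  [set s | dual s /\ forall v, s (v - u) <= phi v - phi u].

End dual.

Section embedding.
Context d (T : measurableType d) (R : realType).
Variable mu : {measure set T -> \bar R}.
Variable X : normedModType R.
Implicit Types (iota : X -> LspaceType1 mu) (f : X -> R^o).

Definition continuous_embedding iota : Prop :=
  [/\ forall (a : R) (u v : X),
        iota (a *: u + v) = (fun x => a * (iota u x : R) + (iota v x : R)) %[ae mu],
      injective iota
    & exists C : R, forall u, norm1 (iota u) <= C * `|u|].

Definition compact_embedding iota : Prop :=
  continuous_embedding iota /\
  forall u : nat -> X, bounded_fun u ->
    exists (phi : nat -> nat) (g : LspaceType1 mu),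
      increasing_seq phi /\ dist1 (iota (u (phi n))) g @[n --> \oo] --> 0.

Definition dense_embedding iota : Prop :=
  continuous_embedding iota /\
  forall (g : LspaceType1 mu) (e : R), 0 < e ->
    exists u, dist1 (iota u) g < e.

(* critical point of  f + rho (|| . ||_1 - | . |_K) *)
Definition critical_point iota f (K rho : R) (u : X) : Prop :=
  subdifferential (fun v => f v + rho * norm1 (iota v)) u `&`
  subdifferential (fun v => rho * largestK_norm K (iota v)) u !=set0.

End embedding.

(* Main.v *)
Require Import Defs.
From HB Require Import structures.
From mathcomp Require Import all_boot all_order all_algebra.
From mathcomp Require Import all_classical all_reals all_analysis.
From mathcomp Require Import measurable_realfun.
From mathcomp Require Import lra.

Set Implicit Arguments.
Unset Strict Implicit.
Unset Printing Implicit Defensive.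

Import Order.TTheory GRing.Theory Num.Theory.
Import numFieldNormedType.Exports.

Local Open Scope classical_set_scope.
Local Open Scope ring_scope.

(** Let [N v = |v|_1] and [L v = |v|_K]. If [s] lies in both subdifferentials at
    [u], homogeneity of [L] gives [s u = rho L u]; testing the subgradient
    inequality of [f + rho N] at [0] gives [f u + rho (N u - L u) <= f 0], and
    testing it along the ray through [u] gives [f'(u) u = rho (L u - N u)].
    Hence [f (u n) <= f 0], so coercivity bounds [u n], and [N - L -> 0] because
    [f] is bounded below. Along a weakly convergent subsequence the compact
    embedding yields an [L^1]-limit, identified with the weak limit by the
    functionals [v |-> \int_A v]; as [N - L] is [L^1]-continuous, [N = L] at the
    limit, which forces the support to have measure at most [K]. Weak lower
    semicontinuity of [f] comes from its gradient inequality. *)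

(** * Integration of $L^1$ classes, the distance [dist1], and the largest-$K$ norm *)

Section L1_theory.
Context d (T : measurableType d) (R : realType).
Variable mu : {measure set T -> \bar R}.
Implicit Types (g h : LspaceType1 mu) (A : set T) (K a c : R).

Lemma measurable_Lspace1 g A : measurable_fun A (g : T -> R).
Proof.
apply: measurable_funTS.
exact: (measurable_funPT (repr (g : {mfun_ mu, T >-> measurableTypeR R}))).
Qed.

Lemma Lspace1_integrable g A : measurable A ->
  mu.-integrable A (EFin \o (g : T -> R)).
Proof.
move=> mA; apply: (@integrableS _ _ _ _ setT) => //; apply/integrableP; split.
  exact/measurable_EFinP/measurable_Lspace1.
by rewrite -Lnorm1; exact: Lebesgue_finite.
Qed.

Lemma Lspace1_integrable_norm g A : measurable A ->
  mu.-integrable A (EFin \o (fun x => `|g x : R|)).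
Proof. by move=> mA; exact/integrable_norm/Lspace1_integrable. Qed.

Lemma Lspace1_integrableB g h A : measurable A ->
  mu.-integrable A (EFin \o (fun x => (g x : R) - h x)).
Proof.
move=> mA.
exact: (integrableB mA (Lspace1_integrable g mA) (Lspace1_integrable h mA)).
Qed.

Lemma norm1E g : norm1 g = \int[mu]_x `|g x : R|.
Proof. by rewrite /norm1 Lnorm1. Qed.

Lemma dist1E g h : dist1 g h = \int[mu]_x `|(g x : R) - h x|.
Proof. by rewrite /dist1 Lnorm1. Qed.

Lemma dist1_ge0 g h : 0 <= dist1 g h.
Proof. by rewrite dist1E; exact: Rintegral_ge0. Qed.

Lemma dist1C g h : dist1 g h = dist1 h g.
Proof. by rewrite !dist1E; apply: eq_Rintegral => x _; rewrite distrC. Qed.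

Lemma ae_eq_Rintegral A (p q : T -> R) : measurable A ->
  measurable_fun A p -> measurable_fun A q -> p = q %[ae mu] ->
  \int[mu]_(x in A) p x = \int[mu]_(x in A) q x.
Proof.
move=> mA mp mq pq; congr fine; apply: ae_eq_integral => //.
- exact/measurable_EFinP.
- exact/measurable_EFinP.
- by apply: filterS pq => x /(_ I) /= -> _.
Qed.

Lemma le_Rintegral_setT A (p : T -> R) : measurable A ->
  mu.-integrable setT (EFin \o p) -> (forall x, 0 <= p x) ->
  \int[mu]_(x in A) p x <= \int[mu]_x p x.
Proof.
move=> mA ip p0; have ipA := integrableS measurableT mA (@subsetT _ A) ip.
apply: fine_le; [exact: integrable_fin_num|exact: integrable_fin_num|].
apply: ge0_subset_integral => //.
- exact: measurable_int ip.
- by move=> x _; rewrite lee_fin.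
Qed.

Lemma Rintegral_dist_le A g h : measurable A ->
  `|\int[mu]_(x in A) (g x : R) - \int[mu]_(x in A) (h x : R)| <= dist1 g h.
Proof.
move=> mA; rewrite -RintegralB//; [|exact: Lspace1_integrable..].
apply: (le_trans (le_normr_Rintegral mA (Lspace1_integrableB g h mA))).
rewrite dist1E; apply: le_Rintegral_setT => //.
exact/integrable_norm/Lspace1_integrableB.
Qed.

Lemma dist1_triangle g k h : dist1 g h <= dist1 g k + dist1 k h.
Proof.
rewrite !dist1E -RintegralD//;
  [|exact/integrable_norm/Lspace1_integrableB..].
apply: le_Rintegral => //; first exact/integrable_norm/Lspace1_integrableB.
  exact: (integrableD measurableT
    (integrable_norm (Lspace1_integrableB g k measurableT))
    (integrable_norm (Lspace1_integrableB k h measurableT))).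
by move=> x _; exact: ler_distD.
Qed.

(** Kept for arbitrary [A] to serve twice: [A = setT] makes [norm1] 1-Lipschitz for [dist1], and the
    supremum over [A] does the same for [largestK_norm]. *)
Lemma Rintegral_norm_le_dist A g h : measurable A ->
  \int[mu]_(x in A) `|g x : R| <= \int[mu]_(x in A) `|h x : R| + dist1 g h.
Proof.
move=> mA; have iB := integrable_norm (Lspace1_integrableB g h mA).
apply: (@le_trans _ _
  (\int[mu]_(x in A) (`|h x : R| + `|(g x : R) - h x|))).
  apply: le_Rintegral => //; first exact: Lspace1_integrable_norm.
    exact: (integrableD mA (Lspace1_integrable_norm h mA) iB).
  by move=> x _; rewrite -[X in `|X|](addrNK (h x : R)) addrC ler_normD.
rewrite RintegralD//; last exact: Lspace1_integrable_norm.
rewrite lerD2l dist1E; apply: le_Rintegral_setT => //.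
exact/integrable_norm/Lspace1_integrableB.
Qed.

Lemma norm1_le_dist g h : norm1 g <= norm1 h + dist1 g h.
Proof. by rewrite !norm1E; exact: Rintegral_norm_le_dist. Qed.

(** The relation between [h] and [g] is only a.e. because the embedding is linear on classes, not on
    chosen representatives. *)
Lemma norm1_scale a g h : (h : T -> R) = (fun x => a * g x) %[ae mu] ->
  norm1 h = `|a| * norm1 g.
Proof.
move=> hag; rewrite !norm1E -RintegralZl//; last exact: Lspace1_integrable_norm.
apply: ae_eq_Rintegral => //.
- exact/measurableT_comp/measurable_Lspace1.
- apply: measurable_funM => //; exact/measurableT_comp/measurable_Lspace1.
- by apply: filterS hag => x /(_ I) /= -> _; rewrite normrM.
Qed.

Let fine_norm_integral A g : measurable A ->
  (\int[mu]_(x in A) `|(g x : R)%:E|)%E = (\int[mu]_(x in A) `|g x : R|)%:E.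
Proof.
move=> mA; rewrite fineK//.
by have := integrable_fin_num mA (Lspace1_integrable_norm g mA).
Qed.

Let largestK_sup K g := ereal_sup
  [set (\int[mu]_(x in A) `|(g x : R)%:E|)%E
    | A in [set A | measurable A /\ (mu A <= K%:E)%E]].

Let largestK_sup_fin K g : 0 <= K -> largestK_sup K g \is a fin_num.
Proof.
move=> K0; rewrite fin_numElt; apply/andP; split.
  apply: (@lt_le_trans _ _ 0%E) => //; apply: ereal_sup_ubound.
  by exists set0; [rewrite /= measure0|rewrite integral_set0].
apply: (@le_lt_trans _ _ (norm1 g)%:E); last exact: ltry.
apply: ub_ereal_sup => _ [A [mA _] <-]; rewrite fine_norm_integral// lee_fin.
rewrite norm1E; apply: le_Rintegral_setT => //.
exact: Lspace1_integrable_norm.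
Qed.

Let largestK_normE K g : 0 <= K -> (largestK_norm K g)%:E = largestK_sup K g.
Proof. by move=> K0; rewrite -(fineK (largestK_sup_fin g K0)). Qed.

Lemma largestK_norm_ge K g A : 0 <= K -> measurable A -> (mu A <= K%:E)%E ->
  \int[mu]_(x in A) `|g x : R| <= largestK_norm K g.
Proof.
move=> K0 mA AK; rewrite -lee_fin largestK_normE//.
by rewrite -fine_norm_integral//; apply: ereal_sup_ubound; exists A.
Qed.

Lemma largestK_norm_le K g c : 0 <= K ->
  (forall A, measurable A -> (mu A <= K%:E)%E ->
    \int[mu]_(x in A) `|g x : R| <= c) ->
  largestK_norm K g <= c.
Proof.
move=> K0 gc; rewrite -lee_fin largestK_normE//.
apply: ub_ereal_sup => _ [A [mA AK] <-].
by rewrite fine_norm_integral// lee_fin gc.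
Qed.

Lemma largestK_norm_le_norm1 K g : 0 <= K -> largestK_norm K g <= norm1 g.
Proof.
move=> K0; apply: largestK_norm_le => // A mA _; rewrite norm1E.
by apply: le_Rintegral_setT => //; exact: Lspace1_integrable_norm.
Qed.

(** This half of homogeneity, at [a = 2] and [a = 0], is what determines the value of a subgradient
    at its base point. *)
Lemma largestK_norm_scale_le K a g h : 0 <= K ->
  (h : T -> R) = (fun x => a * g x) %[ae mu] ->
  largestK_norm K h <= `|a| * largestK_norm K g.
Proof.
move=> K0 hag; apply: largestK_norm_le => // A mA AK.
rewrite (@ae_eq_Rintegral _ _ (fun x => `|a| * `|g x : R|))//.
- rewrite RintegralZl//; last exact: Lspace1_integrable_norm.
  by rewrite ler_wpM2l// largestK_norm_ge.
- exact/measurableT_comp/measurable_Lspace1.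
- apply: measurable_funM => //; exact/measurableT_comp/measurable_Lspace1.
- by apply: filterS hag => x /(_ I) /= -> _; rewrite normrM.
Qed.

Lemma largestK_norm_le_dist K g h : 0 <= K ->
  largestK_norm K g <= largestK_norm K h + dist1 g h.
Proof.
move=> K0; apply: largestK_norm_le => // A mA AK.
apply: (le_trans (Rintegral_norm_le_dist g h mA)).
by rewrite lerD2r largestK_norm_ge.
Qed.

Lemma measurable_level g (e : R) : measurable [set x | e <= `|g x : R|].
Proof.
have mg : measurable_fun setT (fun x => `|g x : R|).
  exact/measurableT_comp/measurable_Lspace1.
have := @measurable_fun_le _ T R setT (cst e) _ measurableT (measurable_cst _) mg.
by rewrite setTI.
Qed.

(* Outside a set [A] of measure at most [K] the level set keeps measure at
   least [mu E - K], which bounds the gap [norm1 g - largestK_norm K g] below. *)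
Lemma level_set_le K g e : 0 <= K -> 0 < e -> norm1 g <= largestK_norm K g ->
  (mu [set x | e <= `|g x : R|]%R <= K%:E)%E.
Proof.
move=> K0 e0 gK; set E := [set _ | _]; have mE : measurable E.
  exact: measurable_level.
have markov A : measurable A ->
    (e%:E * mu (A `&` E) <= (\int[mu]_(x in A) `|g x : R|)%:E)%E.
  move=> mA; rewrite -fine_norm_integral//.
  apply: (@le_integral_abse _ _ _ mu A mA (EFin \o (g : T -> R)) e) => //.
  exact/measurable_EFinP/measurable_Lspace1.
(* Markov's inequality on the whole space bounds [mu E] by [norm1 g / e], so that [mu E - K] is a
   real number. *)
have Efin : mu E \is a fin_num.
  rewrite ge0_fin_numE//; have := markov _ measurableT; rewrite setTI.
  by rewrite -lee_pdivlMl// => /le_lt_trans; apply; rewrite -EFinM ltry.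
rewrite leNgt; apply/negP => KE.
suff : largestK_norm K g <= norm1 g - e * (fine (mu E) - K).
  apply/negP; rewrite -ltNge; apply: lt_le_trans gK.
  by rewrite ltrBlDr ltrDl mulr_gt0// subr_gt0 -lte_fin fineK.
apply: largestK_norm_le => // A mA AK.
rewrite lerBrDr norm1E -(setUv A) Rintegral_setU//; last 3 first.
- exact: measurableC.
- by rewrite setUv; exact: Lspace1_integrable_norm.
- by apply/disj_setPCl.
rewrite lerD2l -lee_fin; apply: le_trans (markov _ (measurableC mA)).
rewrite EFinM lee_pmul2l// EFinB fineK// leeBlDr//.
(* Splitting [E] along [A]: the part inside [A] has measure at most [mu A <= K]. *)
rewrite (measureDI mu mE mA) setDE setIC leeD2l//.
by apply: le_trans AK; apply: le_measure; rewrite ?inE//; exact: measurableI.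
Qed.

(** The support is the increasing union of the level sets [E n], each of measure at most [K] by
    [level_set_le]; continuity of [mu] from below concludes. *)
Lemma norm0_le K g : 0 <= K -> norm1 g <= largestK_norm K g ->
  (norm0 g <= K%:E)%E.
Proof.
move=> K0 gK; pose E n := [set x | n.+1%:R^-1 <= `|g x : R|].
have mE n : measurable (E n) by exact: measurable_level.
have -> : norm0 g = mu (\bigcup_n E n).
  congr (mu _); apply/seteqP; split => x /=.
    (* With [n] the integer part of [1 / |g x|], one has [n + 1 > 1 / |g x|], so [x] lies in
       [E n]. *)
    rewrite -normr_gt0 => gx0; exists (Num.truncn `|g x : R|^-1) => //.
    rewrite /E/= invf_ple ?posrE ?ltr0n//.
    exact/ltW/truncnS_gt.
  by move=> [n _] /=; rewrite /E/= -normr_gt0; exact: lt_le_trans.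
apply: (@cvge_to_le _ _ _ _ _ _ _ (nondecreasing_cvg_mu mE _ _)).
- exact: bigcupT_measurable.
- move=> m n mn; apply/subsetPset => x; apply: le_trans.
  by rewrite lef_pV2 ?posrE// ler_nat ltnS.
- by apply: nearW => n; exact: level_set_le.
Qed.

(** Equal integrals on all measurable sets force a.e. equality; this identifies a strong limit with
    a weak one. *)
Lemma dist1_eq0 g h :
  (forall A, measurable A ->
    \int[mu]_(x in A) (g x : R) = \int[mu]_(x in A) (h x : R)) ->
  dist1 g h = 0.
Proof.
move=> gh; have ae_gh : ae_eq mu setT (EFin \o (g : T -> R)) (EFin \o (h : T -> R)).
  apply: integral_ae_eq => //; first exact: Lspace1_integrable.
    exact/measurable_EFinP/measurable_Lspace1.
  move=> A _ mA.
  rewrite -(fineK (integrable_fin_num mA (Lspace1_integrable g mA))).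
  rewrite -(fineK (integrable_fin_num mA (Lspace1_integrable h mA))).
  by congr (EFin _); exact: gh.
rewrite dist1E (@ae_eq_Rintegral _ _ (cst 0))//.
- by rewrite Rintegral_cst// mul0r.
- apply: measurableT_comp => //.
  by apply: measurable_funB; exact: measurable_Lspace1.
- by apply: filterS ae_gh => x /(_ I) /= [->] _; rewrite subrr normr0.
Qed.
End L1_theory.

Lemma increasing_seq_cvg_infty (phi : nat -> nat) : increasing_seq phi ->
  phi n @[n --> \oo] --> \oo.
Proof.
move=> phi_inc; have ge_id n : (n <= phi n)%N.
  elim: n => // n /leq_ltn_trans; apply.
  by have := leW_mono phi_inc n n.+1; rewrite /Order.lt/= ltnSn.
apply/cvgnyPge => N; near=> n; apply: leq_trans (ge_id n).
by near: n; exact: nbhs_infty_ge.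
Unshelve. all: by end_near. Qed.

(** * One-sided derivatives, continuous functionals and coercivity on a normed space *)

Section normed_space.
Context (R : realType) (X : normedModType R).
Implicit Types (f : X -> R^o) (u v : X) (c : R).

Lemma derivable_right_cvg f u v : derivable f u v ->
  h^-1 * (f (h *: v + u) - f u) @[h --> 0^'+] --> 'D_v f u.
Proof. by move=> fuv; apply: cvg_dnbhs_at_right; exact: fuv. Qed.

(** The derivative is also the limit of the right difference quotients, so small positive [h]
    suffice; [h <= 1] leaves [1 - h] nonnegative for the users. *)
Lemma ge_derive f u v c : derivable f u v ->
  (forall h, 0 < h -> h <= 1 -> h * c <= f (h *: v + u) - f u) ->
  c <= 'D_v f u.
Proof.
move=> fuv hc; apply: (cvgr_to_ge (derivable_right_cvg fuv)).
near=> h; have h0 : 0 < h by near: h; exact: nbhs_right_gt.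
by rewrite ler_pdivlMl// hc//; near: h; exact: nbhs_right_le.
Unshelve. all: by end_near. Qed.

Lemma le_derive f u v c : derivable f u v ->
  (forall h, 0 < h -> h <= 1 -> f (h *: v + u) - f u <= h * c) ->
  'D_v f u <= c.
Proof.
move=> fuv hc; apply: (cvgr_to_le (derivable_right_cvg fuv)).
near=> h; have h0 : 0 < h by near: h; exact: nbhs_right_gt.
by rewrite ler_pdivrMl// hc//; near: h; exact: nbhs_right_le.
Unshelve. all: by end_near. Qed.

(** Convexity on the segment bounds the increment of [f] at [u + h (v - u)] by [h (f v - f u)];
    divide by [h] and let it tend to 0. *)
Lemma convex_gradient_le f u v : gateaux_differentiable f ->
  @convex_function R X setT f -> gateaux_derivative f u (v - u) <= f v - f u.
Proof.
move=> fG fconv; apply: le_derive => [|h h0 h1]; first exact: (fG u).1.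
have := fconv (Itv01 (ltW h0) h1) v u (in_setT _) (in_setT _).
rewrite convRE/= /unstable.onem => hle.
have -> : h *: (v - u) + u = h *: v + (1 - h) *: u.
  by rewrite scalerBr scalerBl scale1r addrAC addrA.
rewrite lerBlDr; apply: le_trans hle _; lra.
Qed.

Lemma dual_of_bounded (s : X -> R^o) (C : R) : linear s ->
  (forall x, `|s x| <= C * `|x|) -> dual s.
Proof.
move=> s_lin sC; split => //.
pose F : {linear X -> R^o} := HB.pack s (GRing.isLinear.Build _ _ _ _ _ s_lin).
apply: (@bounded_linear_continuous _ _ _ F); apply/bounded_funP => r.
(* Absolute values, since neither [C] nor [r] has a known sign. *)
exists (`|C| * `|r|) => x xr; apply: (le_trans (sC x)).
rewrite (le_trans (ler_norm _))// normrM normr_id ler_wpM2l//.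
by rewrite (le_trans xr)// ler_norm.
Qed.

Lemma dualB (s : X -> R^o) u v : dual s -> s (u - v) = s u - s v.
Proof.
move=> [s_lin _].
pose F : {linear X -> R^o} := HB.pack s (GRing.isLinear.Build _ _ _ _ _ s_lin).
exact: (linearB F).
Qed.

Lemma dualZ (s : X -> R^o) (a : R) u : dual s -> s (a *: u) = a * s u.
Proof.
move=> [s_lin _].
pose F : {linear X -> R^o} := HB.pack s (GRing.isLinear.Build _ _ _ _ _ s_lin).
exact: (linearZZ F a u).
Qed.

(** If [u] were unbounded, picking [phi n] with [|u (phi n)| > n] would give norms tending to
    infinity while [f] stays below [c]. Coercivity concerns all sequences, so [phi] may fail to be
    monotone. *)
Lemma coercive_bounded_fun f (u : nat -> X) c : coercive f ->
  (forall n, f (u n) <= c) -> bounded_fun u.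
Proof.
(* [ex_bound] asks for a proper filter; the point [0] makes the one generated by all of [nat]
   proper. *)
move=> fco uc; have ? := @globally_properfilter _ [set: nat] 0%N I.
apply/ex_bound; apply: contrapT => /forallNP unb.
have /choice[phi phiP] : forall n : nat, exists k, n%:R < `|u k|.
  move=> n; apply: contrapT => /forallNP un; apply: (unb n%:R) => k _ /=.
  by rewrite leNgt; exact/negP/un.
have : f (u (phi n)) @[n --> \oo] --> +oo.
  apply: fco; apply/cvgryPge => M; near=> n.
  apply: le_trans (ltW (phiP n)); near: n; exact: nbhs_infty_ger.
move/cvgryPge => /(_ (c + 1)) [N _ /(_ N (leqnn _))] /=.
by apply/negP; rewrite -ltNge (le_lt_trans (uc _))// ltrDl.
Unshelve. all: by end_near. Qed.

End normed_space.

(** * Consequences of the continuous and of the compact embedding into $L^1$ *)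

Section embedding_theory.
Context d (T : measurableType d) (R : realType).
Variable mu : {measure set T -> \bar R}.
Variable X : normedModType R.
Implicit Types (iota : X -> LspaceType1 mu) (f : X -> R^o).

Lemma embedding_scale iota a u : continuous_embedding iota ->
  (iota (a *: u) : T -> R) = (fun x => a * iota u x) %[ae mu].
Proof.
move=> [lin _ _].
(* From [0 = -1 *: 0 + 0], the image of 0 is a.e. minus itself plus itself. *)
have iota0 : \forall x \ae mu, (iota 0 x : R) = 0.
  apply: filterS (lin (-1) 0 0) => x /(_ I).
  by rewrite scaler0 addr0 mulN1r addNr.
apply: filterS2 iota0 (lin a u 0) => x x0 /(_ I).
by rewrite addr0 x0 addr0.
Qed.

(** Bounded because $|\int_A v| \le \|v\|_1 \le C \|v\|_X$; these functionals carry weak convergence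
    in [X] over to integrals. *)
Lemma Rintegral_dual iota (A : set T) : measurable A ->
  continuous_embedding iota ->
  dual (fun v => \int[mu]_(x in A) (iota v x : R) : R^o).
Proof.
move=> mA [lin _ [C iotaC]]; apply: (@dual_of_bounded _ _ _ C).
  move=> a u v.
  rewrite -[RHS]/(a * \int[mu]_(x in A) (iota u x : R) +
    \int[mu]_(x in A) (iota v x : R)).
  rewrite -RintegralZl//; last exact: Lspace1_integrable.
  rewrite -RintegralD//; last exact: Lspace1_integrable.
    apply: ae_eq_Rintegral => //; first exact: measurable_Lspace1.
    apply: measurable_funD; last exact: measurable_Lspace1.
    by apply: measurable_funM => //; exact: measurable_Lspace1.
  exact: (integrableZl mA a (Lspace1_integrable _ mA)).
move=> u; apply: le_trans (iotaC u).
apply: (le_trans (le_normr_Rintegral mA (Lspace1_integrable _ mA))).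
rewrite norm1E; apply: le_Rintegral_setT => //.
exact: Lspace1_integrable_norm.
Qed.

(** Compactness yields an $L^1$-limit [g] of a subsequence. Over each [A] the integrals tend to that
    of [g] by strong convergence and to that of [iota l] by weak convergence, so
    [dist1 g (iota l) = 0]. *)
Lemma compact_embedding_weak_cvg iota (u : nat -> X) l :
  compact_embedding iota -> bounded_fun u -> weak_cvg u l ->
  exists2 phi : nat -> nat, increasing_seq phi &
    dist1 (iota (u (phi n))) (iota l) @[n --> \oo] --> 0.
Proof.
move=> [ciota comp] ub ul; have [phi [g [phi_inc ug]]] := comp u ub.
exists phi => //.
suff gl : dist1 g (iota l) = 0.
  apply: (squeeze_cvgr _ (cvg_cst 0) ug); apply: nearW => n; rewrite dist1_ge0/=.
  by rewrite -[leRHS]addr0 -gl; exact: dist1_triangle.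
apply: dist1_eq0 => A mA.
pose I v := \int[mu]_(x in A) (iota v x : R).
have Il : I (u (phi n)) @[n --> \oo] --> I l.
  have uI := ul _ (Rintegral_dual mA ciota).
  exact: (cvg_comp _ _ (increasing_seq_cvg_infty phi_inc) uI).
suff Ig : I (u (phi n)) @[n --> \oo] --> \int[mu]_(x in A) (g x : R).
  exact: (cvg_unique _ Ig Il).
apply/cvgrPdist_le => e e0; near=> n; rewrite distrC.
apply: (le_trans (Rintegral_dist_le _ _ mA)).
rewrite -[leLHS]ger0_norm ?dist1_ge0// -normrN -sub0r.
by near: n; move/cvgrPdist_le : ug; exact.
Unshelve. all: by end_near. Qed.

(** * Value, energy bound and radial derivative at one critical point *)

Section critical.
Variables (iota : X -> LspaceType1 mu) (f : X -> R^o) (K rho : R) (u : X).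
Hypotheses (ciota : continuous_embedding iota) (K0 : 0 <= K) (rho0 : 0 < rho).
Hypothesis u_critical : critical_point iota f K rho u.

Lemma critical_point_subgradient : exists s : X -> R^o,
  [/\ dual s, s u = rho * largestK_norm K (iota u) &
    forall v, s (v - u) <=
      f v + rho * norm1 (iota v) - (f u + rho * norm1 (iota u))].
Proof.
have [s [[sd sg] [_ sh]]] := u_critical; exists s; split => //.
have scale a : largestK_norm K (iota (a *: u)) <=
    `|a| * largestK_norm K (iota u).
  exact/largestK_norm_scale_le/embedding_scale.
apply/eqP; rewrite eq_le; apply/andP; split.
  (* Test at [2 *: u]: [s u <= rho (L (2u) - L u) <= rho L u], where [L] is the largest-$K$ norm. *)
  have := sh (2 *: u); rewrite dualB// dualZ//.
  have := scale 2; rewrite ger0_norm//.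
  rewrite -(ler_pM2l rho0) => /[swap].
  set L := largestK_norm K (iota u).
  set L2 := largestK_norm _ _; lra.
(* Test at the origin, written [0 *: u] so that [scale] applies: [- s u <= - rho L u]. *)
have := sh (0 *: u); rewrite dualB// dualZ//.
have := scale 0; rewrite normr0 -(ler_pM2l rho0).
set L := largestK_norm K (iota u).
set L2 := largestK_norm _ _; lra.
Qed.

Let norm1_embedding_scale a :
  norm1 (iota (a *: u)) = `|a| * norm1 (iota u).
Proof. exact/norm1_scale/embedding_scale. Qed.

(** Source of both the bound [f u <= f 0] and the decay rate of the gap, of order [1 / rho]. *)
Lemma critical_point_le :
  f u + rho * (norm1 (iota u) - largestK_norm K (iota u)) <= f 0.
Proof.
have [s [sd su]] := critical_point_subgradient.
move=> /(_ (0 *: u)); rewrite norm1_embedding_scale dualB// dualZ// su.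
rewrite normr0 scale0r; lra.
Qed.

Lemma critical_point_derivative : gateaux_differentiable f ->
  gateaux_derivative f u u =
  rho * (largestK_norm K (iota u) - norm1 (iota u)).
Proof.
move=> fG; have [s [sd su sg]] := critical_point_subgradient.
have [fu fd] := fG u.
apply/eqP; rewrite eq_le; apply/andP; split.
  (* By linearity of the derivative, the upper bound is a lower bound in the direction [- u]; the
     test points are [(1 - h) *: u], along which the 1-norm is affine. *)
  rewrite -lerN2.
  have -> : - gateaux_derivative f u u = gateaux_derivative f u (- u).
    by rewrite -[in RHS]scaleN1r dualZ// mulN1r.
  apply: ge_derive => // h h0 h1; have := sg ((1 - h) *: u).
  rewrite norm1_embedding_scale dualB// dualZ// su ger0_norm ?subr_ge0//.
  have -> : h *: - u + u = (1 - h) *: u.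
    by rewrite scalerN scalerBl scale1r addrC.
  lra.
apply: ge_derive => // h h0 h1; have := sg ((1 + h) *: u).
rewrite norm1_embedding_scale dualB// dualZ// su.
rewrite (ger0_norm (addr_ge0 ler01 (ltW h0))).
have -> : h *: u + u = (1 + h) *: u by rewrite scalerDl scale1r addrC.
lra.
Qed.

End critical.
End embedding_theory.

Theorem theorem5p14 (R : realType) (d : measure_display) (T : measurableType d)
    (mu : {measure set T -> \bar R}) (mu_sigma_finite : sigma_finite setT mu)
    (K : R) (K_gt0 : 0 < K) (K_lt : (K%:E < mu setT)%E)
    (X : completeNormedModType R) (X_reflexive : reflexive_space X)
    (iota : X -> LspaceType1 mu)
    (iota_compact : compact_embedding iota) (iota_dense : dense_embedding iota)
    (f : X -> R^o)
    (f_lsc : lower_semicontinuous (EFin \o f))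
    (f_convex : @convex_function R X setT f)
    (f_bounded_below : has_lbound (range f))
    (f_coercive : coercive f)
    (f_gateaux : gateaux_differentiable f)
    (rho : nat -> R) (rho_gt0 : forall n, 0 < rho n)
    (rho_cvg : rho n @[n --> \oo] --> +oo)
    (u : nat -> X) (u_critical : forall n, critical_point iota f K (rho n) (u n)) :
  [/\ bounded_fun u,
      norm1 (iota (u n)) - largestK_norm K (iota (u n)) @[n --> \oo] --> 0,
      forall ubar : X, weak_accumulation_point u ubar ->
        (norm0 (iota ubar) <= K%:E)%E /\ f ubar <= f 0
    & forall n, gateaux_derivative f (u n) (u n) \in `[inf (range f) - f 0, 0]].
Proof.
have K0 := ltW K_gt0; have ciota := iota_compact.1.
have fB n : inf (range f) <= f (u n).
  by apply: ge_inf => //; exists (u n).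
have gap_ge0 n : 0 <= norm1 (iota (u n)) - largestK_norm K (iota (u n)).
  by rewrite subr_ge0 largestK_norm_le_norm1.
have fu0 n : f (u n) +
    rho n * (norm1 (iota (u n)) - largestK_norm K (iota (u n))) <= f 0.
  exact: critical_point_le.
have fu_le n : f (u n) <= f 0.
  by apply: le_trans (fu0 n); rewrite lerDl mulr_ge0// ltW.
have gap_cvg :
    norm1 (iota (u n)) - largestK_norm K (iota (u n)) @[n --> \oo] --> 0.
  (* The gap lies between 0 and [(f 0 - inf f) / rho n]. *)
  have rhoV : (f 0 - inf (range f)) * (rho n)^-1 @[n --> \oo] --> 0.
    rewrite -[X in _ --> X](mulr0 (f 0 - inf (range f))).
    by apply: cvgMr; apply/gtr0_cvgV0 => //; exact: nearW.
  apply: (squeeze_cvgr _ (cvg_cst 0) rhoV); apply: nearW => n.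
  rewrite gap_ge0/= ler_pdivlMr// mulrC.
  have := fu0 n; have := fB n; lra.
have u_bounded : bounded_fun u by exact: coercive_bounded_fun fu_le.
split => // [ubar [phi phi_inc uphi]|n]; last first.
  (* The derivative equals [- rho n] times the gap: nonpositive, and at least [f (u n) - f 0] by
     [fu0]. *)
  rewrite in_itv/= (critical_point_derivative ciota K0 (rho_gt0 n))//.
  have := fu0 n; have := fB n.
  have := mulr_ge0 (ltW (rho_gt0 n)) (gap_ge0 n).
  by move=> *; apply/andP; split; lra.
split; last first.
  have [_ fd] := f_gateaux ubar.
  (* Weak lower semicontinuity: the affine minorant of [f] at [ubar] stays below [f 0] along the
     subsequence and, its slope being in the dual, tends to [f ubar]. *)
  have gradient_cvg : f ubar + (gateaux_derivative f ubar (u (phi n))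
      - gateaux_derivative f ubar ubar) @[n --> \oo] --> f ubar.
    rewrite -[X in _ --> X]addr0; apply: cvgD; first exact: cvg_cst.
    rewrite -(subrr (gateaux_derivative f ubar ubar)).
    by apply: cvgB; [exact: uphi|exact: cvg_cst].
  apply: (cvgr_to_le gradient_cvg).
  apply: nearW => n; rewrite -dualB//.
  have := convex_gradient_le ubar (u (phi n)) f_gateaux f_convex.
  have := fu_le (phi n); lra.
have uphi_bounded : bounded_fun (u \o phi).
  by apply: coercive_bounded_fun f_coercive _ => n; exact: fu_le.
have [psi psi_inc du] := compact_embedding_weak_cvg iota_compact uphi_bounded uphi.
apply: norm0_le => //; rewrite -subr_le0.
(* Upper bound for the gap at [ubar]: the factor 2 counts one [dist1] for [norm1] and one for
   [largestK_norm]. *)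
have lim0 : norm1 (iota (u (phi (psi n)))) - largestK_norm K (iota (u (phi (psi n))))
    + dist1 (iota (u (phi (psi n)))) (iota ubar) *+ 2 @[n --> \oo] --> 0.
  rewrite -[X in _ --> X](addr0 0) -[X in _ + X](mul0rn R 2).
  apply: cvgD; last exact: cvgMn.
  have phipsi := cvg_comp _ _ (increasing_seq_cvg_infty psi_inc)
    (increasing_seq_cvg_infty phi_inc).
  exact: (cvg_comp _ _ phipsi gap_cvg).
apply: (cvgr_to_ge lim0); apply: nearW => n.
have := norm1_le_dist (iota ubar) (iota (u (phi (psi n)))).
have := largestK_norm_le_dist (iota (u (phi (psi n)))) (iota ubar) K0.
by rewrite dist1C; lra.
Qed.
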